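(* Let $(L,g_L)$ and $(N,g_N)$ be connected and complete Riemannian manifolds without boundary, let $\alpha\colon L\to\mathbb{R}$ be smooth and positive, and consider the semi-Riemannian warped product $L\times_\alpha N:=(L\times N,\ g:=-g_L+\alpha^2 g_N)$, of dimension at least $3$. Let $f_L\colon L\to\mathbb{R}$ and $f_N\colon N\to\mathbb{R}$ be transnormal functions with $|\nabla_{g_L}f_L|_{g_L}^2=a_{f_L}\circ f_L$ and $|\nabla_{g_N}f_N|_{g_N}^2=a_{f_N}\circ f_N$, and set $I_{f_L}:=\mathrm{Im}\,f_L$, $I_{f_N}:=\mathrm{Im}\,f_N$. Let $F\colon(L\times N)\times\mathbb{R}^2\to\mathbb{R}$ be a $C^2$ function which is $(f_L\times f_N)$-invariant in the first variable, with associated function $\widehat F$, and let $w\colon\mathbb{R}^2\to\mathbb{R}$ be smooth. If $\alpha=\widehat\alpha\circ f_L$ with $\widehat\alpha\colon\mathbb{R}\to\mathbb{R}$ smooth, then $u=w(f_L,f_N)$, i.e. $u(x,z)=w(f_L(x),f_N(z))$, is a solution of $$F(x,z,u,\langle\nabla_g u,\nabla_g u\rangle_g)=0\qquad\text{on }L\times_\alpha N$$ if and only if $w$ satisfies $$\widehat F\left(t,s,w(t,s),-a_{f_L}(t)\,w_t^2(t,s)+\frac{a_{f_N}(s)}{\widehat\alpha^2(t)}\,w_s^2(t,s)\right)=0\qquad\text{in }I_{f_L}\times I_{f_N},$$ where $w_t:=\frac{\partial w}{\partial t}$ and $w_s:=\frac{\partial w}{\partial s}$.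
   Context: A smooth function $f\colon M\to\mathbb{R}$ on a (semi-)Riemannian manifold $(M,g)$ is called transnormal if there is a smooth function $a\colon\mathbb{R}\to\mathbb{R}$ such that $\langle\nabla_g f,\nabla_g f\rangle_g=a\circ f$, where $\nabla_g$ denotes the gradient with respect to $g$. $F\colon(L\times N)\times\mathbb{R}^2\to\mathbb{R}$ is $(f_L\times f_N)$-invariant in the first variable if $F(x_1,z_1,r,\tau)=F(x_2,z_2,r,\tau)$ for all $(r,\tau)\in\mathbb{R}^2$ whenever $f_L(x_1)=f_L(x_2)$ and $f_N(z_1)=f_N(z_2)$. In that case $\widehat F\colon I_{f_L}\times I_{f_N}\times\mathbb{R}^2\to\mathbb{R}$ denotes the function with $F(x,z,r,\tau)=\widehat F(f_L(x),f_N(z),r,\tau)$. *)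

(* Defs.v *)
From HB Require Import structures.
From mathcomp Require Import all_boot all_order all_algebra.
From mathcomp Require Import all_classical all_reals all_analysis.

Set Implicit Arguments.
Unset Strict Implicit.
Unset Printing Implicit Defensive.

Import Order.TTheory GRing.Theory Num.Theory.
Import numFieldNormedType.Exports.

Local Open Scope classical_set_scope.
Local Open Scope ring_scope.

(* [Ck k U f]: f is of class C^k on U. It is meant for U open and V of finite
   dimension, where continuity (or C^k regularity) of the operator-valued
   differential amounts to that of each of its values x |-> 'd f x v. *)
Fixpoint Ck (R : realType) (V W : normedModType R) (k : nat) (U : set V)
    (f : V -> W) : Prop :=
  match k with
  | 0 => forall x, U x -> {for x, continuous f}
  | k'.+1 => (forall x, U x -> differentiable f x) /\
             (forall v : V, Ck k' U (fun x => 'd f x v))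
  end.

Definition Cinf (R : realType) (V W : normedModType R) (U : set V)
  (f : V -> W) : Prop := forall k, Ck k U f.

(* A chart of M with values in E. [cmap] and [cinv] are total functions; only
   [cmap] on [cdom] and [cinv] on [cimg] are meaningful. *)
Record chart (R : realType) (E : normedModType R) (M : topologicalType) :=
  Chart {
    cdom : set M;
    cmap : M -> E;
    cinv : E -> M
  }.

Definition cimg (R : realType) (E : normedModType R) (M : topologicalType)
  (c : chart E M) : set E := cmap c @` cdom c.

Definition is_chart (R : realType) (E : normedModType R) (M : topologicalType)
    (c : chart E M) : Prop :=
  [/\ open (cdom c),
      open (cimg c),
      forall p, cdom c p -> cinv c (cmap c p) = p,
      forall p, cdom c p -> {for p, continuous (cmap c)} &
      forall x, cimg c x -> {for x, continuous (cinv c)}].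

(* Besides the atlas, a preferred chart around each point is part of the data.
   The tangent space at p is E, a vector being identified with its coordinates
   in the preferred chart at p. *)
Record charted (R : realType) (E : normedModType R) (M : topologicalType) :=
  Charted {
    atlas : set (chart E M);
    chart_at : M -> chart E M
  }.

(* Manifolds have no boundary: charts take values in open subsets of E. *)
Definition smooth_manifold (R : realType) (E : normedModType R)
    (M : topologicalType) (A : charted E M) : Prop :=
  [/\ hausdorff_space M /\ @second_countable M,
      forall c, atlas A c -> is_chart c,
      forall p, atlas A (chart_at A p) /\ cdom (chart_at A p) p &
      forall c c', atlas A c -> atlas A c' ->
        Cinf (cmap c @` (cdom c `&` cdom c')) (cmap c' \o cinv c)].

Definition charted_self (R : realType) (E : normedModType R) : charted E E :=
  let c := Chart setT id id in Charted [set c] (fun=> c).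

Definition chart_prod (R : realType) (E1 E2 : normedModType R)
    (M1 M2 : topologicalType) (c1 : chart E1 M1) (c2 : chart E2 M2) :
    chart (E1 * E2)%type (M1 * M2)%type :=
  Chart (cdom c1 `*` cdom c2)
        (fun p => (cmap c1 p.1, cmap c2 p.2))
        (fun x => (cinv c1 x.1, cinv c2 x.2)).

Definition charted_prod (R : realType) (E1 E2 : normedModType R)
    (M1 M2 : topologicalType) (A1 : charted E1 M1) (A2 : charted E2 M2) :
    charted (E1 * E2)%type (M1 * M2)%type :=
  Charted
    [set c | exists c1 c2, [/\ atlas A1 c1, atlas A2 c2 & c = chart_prod c1 c2]]
    (fun p => chart_prod (chart_at A1 p.1) (chart_at A2 p.2)).

(* f is of class C^k, as a map between manifolds, on the open set D. *)
Definition Ck_on (R : realType) (E1 E2 : normedModType R)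
    (M1 M2 : topologicalType) (A1 : charted E1 M1) (A2 : charted E2 M2)
    (k : nat) (D : set M1) (f : M1 -> M2) : Prop :=
  (forall p, D p -> {for p, continuous f}) /\
  (forall c c', atlas A1 c -> atlas A2 c' ->
     Ck k (cmap c @` (cdom c `&` D `&` f @^-1` cdom c'))
          (cmap c' \o f \o cinv c)).

Definition Ck_fun (R : realType) (E : normedModType R) (M : topologicalType)
    (A : charted E M) (k : nat) (f : M -> R) : Prop :=
  Ck_on A (charted_self (R : normedModType R)) k setT f.

Definition smooth_fun (R : realType) (E : normedModType R)
    (M : topologicalType) (A : charted E M) (f : M -> R) : Prop :=
  forall k, Ck_fun A k f.

(* Differential T_p M1 -> T_(f p) M2, read in the preferred charts. *)
Definition mdiff (R : realType) (E1 E2 : normedModType R)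
    (M1 M2 : topologicalType) (A1 : charted E1 M1) (A2 : charted E2 M2)
    (f : M1 -> M2) (p : M1) : E1 -> E2 :=
  'd (cmap (chart_at A2 (f p)) \o f \o cinv (chart_at A1 p))
     (cmap (chart_at A1 p) p).

Definition dfun (R : realType) (E : normedModType R) (M : topologicalType)
    (A : charted E M) (f : M -> R) (p : M) : E -> R :=
  mdiff A (charted_self (R : normedModType R)) f p.

(* A field of bilinear forms on the tangent spaces. *)
Definition tensor (R : realType) (E : normedModType R) (M : topologicalType) :=
  M -> E -> E -> R.

(* Smoothness is that of the components of g in each chart c; the coordinates
   v in the chart c are transported to those in the preferred chart at the
   base point by the differential of the transition map. *)
Definition metric_tensor (R : realType) (E : normedModType R)
    (M : topologicalType) (A : charted E M) (g : tensor E M) : Prop :=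
  [/\ forall p (a : R) u v w, g p (a *: u + v) w = a * g p u w + g p v w,
      forall p v w, g p v w = g p w v &
      forall c, atlas A c -> forall v w : E,
        Cinf (cimg c)
          (fun x : E => let p := cinv c x in
             let T : E -> E := 'd (cmap (chart_at A p) \o cinv c) x in
             g p (T v) (T w))].

Definition riemannian (R : realType) (E : normedModType R)
    (M : topologicalType) (A : charted E M) (g : tensor E M) : Prop :=
  metric_tensor A g /\ forall p v, v != 0 -> 0 < g p v v.

(* The vector v with g(v, w) = df(w) for all w; when g is nondegenerate (and E
   has finite dimension) it exists and is unique. *)
Definition gradient (R : realType) (E : normedModType R) (M : topologicalType)
    (A : charted E M) (g : tensor E M) (f : M -> R) (p : M) : E :=
  xget 0 [set v | forall w, g p v w = dfun A f p w].

Definition grad_sq (R : realType) (E : normedModType R) (M : topologicalType)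
    (A : charted E M) (g : tensor E M) (f : M -> R) (p : M) : R :=
  g p (gradient A g f p) (gradient A g f p).

Definition transnormal_with (R : realType) (E : normedModType R)
    (M : topologicalType) (A : charted E M) (g : tensor E M)
    (f : M -> R) (a : R -> R) : Prop :=
  [/\ smooth_fun A f, Cinf [set: R] a & forall p, grad_sq A g f p = a (f p)].

Definition velocity (R : realType) (E : normedModType R) (M : topologicalType)
    (A : charted E M) (gamma : R -> M) (t : R) : E :=
  mdiff (charted_self (R : normedModType R)) A gamma t 1.

Definition smooth_curve (R : realType) (E : normedModType R)
    (M : topologicalType) (A : charted E M) (gamma : R -> M) : Prop :=
  exists2 e : R, 0 < e &
    forall k, Ck_on (charted_self (R : normedModType R)) A k
                    [set` `]- e, 1 + e[] gamma.

Definition curve_length (R : realType) (E : normedModType R)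
    (M : topologicalType) (A : charted E M) (g : tensor E M)
    (gamma : R -> M) : \bar R :=
  (\int[@lebesgue_measure R]_(t in [set` `[0%R, 1%R]])
     (Num.sqrt (g (gamma t) (velocity A gamma t) (velocity A gamma t)))%:E)%E.

(* [joined A g p q l]: some piecewise smooth curve from p to q has length l. *)
Inductive joined (R : realType) (E : normedModType R) (M : topologicalType)
    (A : charted E M) (g : tensor E M) : M -> M -> \bar R -> Prop :=
  | joined_refl p : joined A g p p 0%E
  | joined_step (gamma : R -> M) q l : smooth_curve A gamma ->
      joined A g (gamma 1) q l ->
      joined A g (gamma 0) q (curve_length A g gamma + l)%E.

Definition rdist (R : realType) (E : normedModType R) (M : topologicalType)
    (A : charted E M) (g : tensor E M) (p q : M) : \bar R :=
  ereal_inf [set l | joined A g p q l].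

Definition complete_riemannian (R : realType) (E : normedModType R)
    (M : topologicalType) (A : charted E M) (g : tensor E M) : Prop :=
  forall u : nat -> M,
    (forall e : R, 0 < e -> exists n0 : nat, forall i j,
       (n0 <= i)%N -> (n0 <= j)%N -> (rdist A g (u i) (u j) < e%:E)%E) ->
    exists p, (fun n => rdist A g (u n) p) @ \oo --> 0%E.

(* The metric - gL + alpha^2 gN on L x N. *)
Definition warped_metric (R : realType) (EL EN : normedModType R)
    (L N : topologicalType) (gL : tensor EL L) (gN : tensor EN N)
    (alpha : L -> R) : tensor (EL * EN)%type (L * N)%type :=
  fun p v w => - gL p.1 v.1 w.1 + alpha p.1 ^+ 2 * gN p.2 v.2 w.2.

Definition invariant_first (R : realType) (L N : topologicalType)
    (fL : L -> R) (fN : N -> R) (F : (L * N) * (R * R) -> R) : Prop :=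
  forall x1 x2 z1 z2, fL x1 = fL x2 -> fN z1 = fN z2 ->
    forall r tau, F ((x1, z1), (r, tau)) = F ((x2, z2), (r, tau)).

(* Main.v *)
Require Import Defs.
From HB Require Import structures.
From mathcomp Require Import all_boot all_order all_algebra.
From mathcomp Require Import all_classical all_reals all_analysis.
From mathcomp Require Import ring.

Set Implicit Arguments.
Unset Strict Implicit.
Unset Printing Implicit Defensive.

Import Order.TTheory GRing.Theory Num.Theory.
Import numFieldNormedType.Exports.

Local Open Scope classical_set_scope.
Local Open Scope ring_scope.

(** The equation for u and the one for w are the same equation, read at a point
    (x, z) and at its image (fL x, fN z). What has to be seen is that the square
    of the gradient of u = w(fL, fN) is itself a function of (fL, fN), namely
    - aL(t) w_t^2 + (aN(s) / alphahat(t)^2) w_s^2.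

    By the chain rule ([dfun_product]) du = w_t dfL + w_s dfN. The warped metric
    makes the factors orthogonal and multiplies gL by -1 and gN by alpha^2, so
    du is represented by the vector (- w_t grad fL, (w_s / alpha^2) grad fN);
    evaluating the metric on it gives - w_t^2 |grad fL|^2 +
    (w_s^2 / alpha^2) |grad fN|^2 ([grad_sq_warped]), and transnormality turns
    the squared norms into aL(fL) and aN(fN). The gradients on the two factors
    do represent dfL and dfN because a positive definite form in finite
    dimension represents every linear form ([riemannian_gradientP]).

    The equivalence follows since every (t, s) in range fL x range fN is
    (fL x, fN z) for some (x, z), and every (x, z) has its image there. *)

Lemma scalable_of_scalar (R : pzRingType) (V : lmodType R) (l : V -> R) :
  scalar l -> forall a u, l (a *: u) = a * l u.
Proof.
move=> linl a u.
pose lin : {scalar V} := HB.pack l (GRing.isLinear.Build _ _ _ _ l linl).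
by rewrite -[LHS]/(lin _) linearZ.
Qed.

Lemma scalar_row_sum (R : nzRingType) (m : nat) (l : 'rV[R]_m -> R) :
  scalar l -> forall v, l v = \sum_(j < m) v 0 j * l (delta_mx 0 j).
Proof.
move=> linl v.
pose lin : {scalar 'rV[R]_m} :=
  HB.pack l (GRing.isLinear.Build _ _ _ _ l linl).
rewrite {1}[v]row_sum_delta -[LHS]/(lin _) linear_sum.
by apply: eq_bigr => j _; exact: scalable_of_scalar.
Qed.

(** The Riesz representation in finite dimension: positive definiteness makes
    the Gram matrix [G] of [B] in the canonical basis injective, hence
    invertible, and the representing vector is read off from [invmx G]. *)
Lemma posdef_represents (R : realFieldType) (m : nat)
    (B : 'rV[R]_m -> 'rV[R]_m -> R) (l : 'rV[R]_m -> R) :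
  (forall w, scalar (B ^~ w)) -> (forall v w, B v w = B w v) ->
  (forall v, v != 0 -> 0 < B v v) -> scalar l ->
  exists v, forall w, B v w = l w.
Proof.
move=> linB symB posB linl.
have linBr v : scalar (B v) by move=> a u w; rewrite !(symB v) linB.
pose G := \matrix_(i < m, j < m) B (delta_mx 0 i) (delta_mx 0 j).
have GE v j : (v *m G) 0 j = B v (delta_mx 0 j).
  rewrite (scalar_row_sum (linB _)) mxE.
  by apply: eq_bigr => i _; rewrite mxE.
have Gunit : G \in unitmx.
  rewrite -row_free_unit; apply: inj_row_free => v vG0.
  apply/eqP; apply: contraTT isT => /posB.
  rewrite (scalar_row_sum (linBr v)) big1 ?ltxx// => j _.
  by rewrite -GE vG0 mxE mulr0.
exists ((\row_j l (delta_mx 0 j)) *m invmx G) => w.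
rewrite (scalar_row_sum (linBr _)) (scalar_row_sum linl).
by apply: eq_bigr => j _; rewrite -GE mulmxKV// mxE.
Qed.

(** [gradient] is a choice among the vectors representing the differential, so
    its value is only known up to the radical of [g p]. The square does not see
    that ambiguity: if v and v' both represent df, then
    g(v', v') = df(v') = g(v, v') = g(v', v) = df(v) = g(v, v) by symmetry.
    Exhibiting one representing vector therefore computes the square also for
    an indefinite metric, without discussing its nondegeneracy. *)
Lemma grad_sqE (R : realType) (E : normedModType R) (M : topologicalType)
    (A : charted E M) (g : tensor E M) (f : M -> R) (p : M) (v : E) :
  (forall v w, g p v w = g p w v) ->
  (forall w, g p v w = dfun A f p w) -> grad_sq A g f p = g p v v.
Proof.
move=> symg gv.
have gradP w : g p (gradient A g f p) w = dfun A f p w.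
  by move: w; apply: (@xgetPex _ 0 [set v | forall w, g p v w = dfun A f p w]);
    exists v.
by rewrite /grad_sq gradP -gv symg gradP -gv.
Qed.

Lemma dfun_scalar (R : realType) (E : normedModType R) (M : topologicalType)
    (A : charted E M) (f : M -> R) (p : M) : scalar (dfun A f p).
Proof. by move=> a u v; rewrite /dfun /mdiff linearP. Qed.

Lemma riemannian_gradientP (R : realType) (m : nat) (M : topologicalType)
    (A : charted 'rV[R]_m M) (g : tensor 'rV[R]_m M) (f : M -> R) (p : M) :
  riemannian A g -> forall w, g p (gradient A g f p) w = dfun A f p w.
Proof.
move=> [[ling symg _] posg].
apply: (@xgetPex _ 0 [set v | forall w, g p v w = dfun A f p w]).
apply: posdef_represents => [w a u v|v w|v|]; first exact: ling.
- exact: symg.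
- exact: posg.
- exact: dfun_scalar.
Qed.

(** Regularity in the sense of [smooth_fun] is asked in every chart of the
    atlas, and the preferred chart, in which [dfun] is computed, is one. *)
Lemma smooth_fun_differentiable (R : realType) (E : normedModType R)
    (M : topologicalType) (A : charted E M) (f : M -> R) (p : M) :
  smooth_manifold A -> smooth_fun A f ->
  differentiable (f \o cinv (chart_at A p)) (cmap (chart_at A p) p).
Proof.
move=> [_ _ atA _] /(_ 1%N)[_ fC1]; have [cA cp] := atA p.
have [+ _] := fC1 _ (Chart setT id id) cA erefl; apply.
by exists p.
Qed.

(** The difference quotients of a partial function are those of [w] along a
    coordinate vector of the plane. *)
Lemma partial1E (R : realType) (w : R * R -> R) (t s : R) :
  differentiable w (t, s) ->
  derive1 (fun t' => w (t', s)) t = 'd w (t, s) (1, 0).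
Proof.
move=> dw; rewrite derive1E -deriveE// /derive.
set q := (fun _ : R => _); set q' := (fun _ : R => _).
suff -> : q = q' by []; apply/funext => h.
rewrite /q /q' /=; congr (_ *: (w _ - _)).
rewrite -[RHS]/(h *: (1 : R) + t, h *: (0 : R) + s).
by rewrite scaler0 add0r.
Qed.

Lemma partial2E (R : realType) (w : R * R -> R) (t s : R) :
  differentiable w (t, s) ->
  derive1 (fun s' => w (t, s')) s = 'd w (t, s) (0, 1).
Proof.
move=> dw; rewrite derive1E -deriveE// /derive.
set q := (fun _ : R => _); set q' := (fun _ : R => _).
suff -> : q = q' by []; apply/funext => h.
rewrite /q /q' /=; congr (_ *: (w _ - _)).
rewrite -[RHS]/(h *: (0 : R) + t, h *: (1 : R) + s).
by rewrite scaler0 add0r.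
Qed.

(** The chain rule: in the product of the preferred charts, the function is
    [w] composed with a pair of maps, each of which depends on one factor only,
    so its differential splits along the coordinate vectors of the plane. *)
Lemma dfun_product (R : realType) (EL EN : normedModType R)
    (L N : topologicalType) (AL : charted EL L) (AN : charted EN N)
    (fL : L -> R) (fN : N -> R) (w : R * R -> R) (x : L) (z : N)
    (v : EL * EN) :
  smooth_manifold AL -> smooth_manifold AN ->
  smooth_fun AL fL -> smooth_fun AN fN ->
  differentiable w (fL x, fN z) ->
  dfun (charted_prod AL AN) (fun p => w (fL p.1, fN p.2)) (x, z) v =
    derive1 (fun t => w (t, fN z)) (fL x) * dfun AL fL x v.1 +
    derive1 (fun s => w (fL x, s)) (fN z) * dfun AN fN z v.2.
Proof.
move=> mL mN sL sN dw.
have kL : cinv (chart_at AL x) (cmap (chart_at AL x) x) = x.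
  by case: mL => _ chL /(_ x)[/chL[_ _ + _ _] xd] _; apply.
have kN : cinv (chart_at AN z) (cmap (chart_at AN z) z) = z.
  by case: mN => _ chN /(_ z)[/chN[_ _ + _ _] zd] _; apply.
have dL := smooth_fun_differentiable x mL sL.
have dN := smooth_fun_differentiable z mN sN.
rewrite /dfun /mdiff /=.
set a := cmap (chart_at AL x) x in kL dL *.
set b := cmap (chart_at AN z) z in kN dN *.
set hL := fL \o cinv _ in dL.
set hN := fN \o cinv _ in dN.
have hLa : hL a = fL x by rewrite /hL /= kL.
have hNb : hN b = fN z by rewrite /hN /= kN.
have contfst : continuous (fst : EL * EN -> EL) by move=> ?; apply: cvg_fst.
have contsnd : continuous (snd : EL * EN -> EN) by move=> ?; apply: cvg_snd.
have d1 : differentiable (fst : EL * EN -> EL) (a, b).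
  exact: linear_differentiable.
have d2 : differentiable (snd : EL * EN -> EN) (a, b).
  exact: linear_differentiable.
have dL1 : differentiable (hL \o fst) (a, b) by apply: differentiable_comp.
have dN2 : differentiable (hN \o snd) (a, b) by apply: differentiable_comp.
have dp := differentiable_pair dL1 dN2.
have dw' : differentiable w (hL a, hN b) by rewrite hLa hNb.
have E1 := diff_comp dp dw'.
have E2 := diff_pair dL1 dN2.
have E3 : 'd (hL \o fst) (a, b) v = 'd hL a v.1.
  by rewrite diff_comp//= diff_lin.
have E4 : 'd (hN \o snd) (a, b) v = 'd hN b v.2.
  by rewrite diff_comp//= diff_lin.
transitivity ('d w (fL x, fN z) ('d hL a v.1, 'd hN b v.2)).
  have := congr1 (fun h => h v) E1; rewrite /= => ->.
  by rewrite E2 E3 E4 hLa hNb.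
have W1 : 'd w (fL x, fN z) (1, 0) = derive1 (fun t => w (t, fN z)) (fL x).
  by rewrite partial1E.
have W2 : 'd w (fL x, fN z) (0, 1) = derive1 (fun s => w (fL x, s)) (fN z).
  by rewrite partial2E.
rewrite -W1 -W2.
rewrite -[X in _ = _ * X + _]/('d hL a v.1).
rewrite -[X in _ = _ + _ * X]/('d hN b v.2).
set p := 'd hL a v.1; set q := 'd hN b v.2.
have -> : (p, q) = p *: ((1, 0) : R * R) + q *: (0, 1).
  rewrite -[RHS]/(p * 1 + q * 0, p * 0 + q * 1).
  by rewrite !(mulr1, mulr0, addr0, add0r).
by rewrite linearD !linearZ; congr (_ + _); apply: mulrC.
Qed.

(** The differential of u = w(fL, fN) is w_t dfL + w_s dfN. For the metric
    - gL + alpha^2 gN it is represented by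
    (- w_t grad fL, (w_s / alpha^2) grad fN), and the two summands of the metric
    contribute - w_t^2 |grad fL|^2 and
    alpha^2 (w_s / alpha^2)^2 |grad fN|^2 to its square. *)
Lemma grad_sq_warped (R : realType) (m n : nat) (L N : topologicalType)
    (AL : charted 'rV[R]_m L) (AN : charted 'rV[R]_n N)
    (gL : tensor 'rV[R]_m L) (gN : tensor 'rV[R]_n N) (alpha : L -> R)
    (fL : L -> R) (fN : N -> R) (w : R * R -> R) (x : L) (z : N) :
  smooth_manifold AL -> smooth_manifold AN ->
  riemannian AL gL -> riemannian AN gN -> alpha x != 0 ->
  smooth_fun AL fL -> smooth_fun AN fN ->
  differentiable w (fL x, fN z) ->
  grad_sq (charted_prod AL AN) (warped_metric gL gN alpha)
      (fun p => w (fL p.1, fN p.2)) (x, z) =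
    - grad_sq AL gL fL x * derive1 (fun t => w (t, fN z)) (fL x) ^+ 2 +
    grad_sq AN gN fN z / alpha x ^+ 2 *
      derive1 (fun s => w (fL x, s)) (fN z) ^+ 2.
Proof.
move=> mL mN rL rN alpha0 sL sN dw.
have [[linL symL _] _] := rL; have [[linN symN _] _] := rN.
set wt := derive1 _ _; set ws := derive1 _ _.
have gLZ a u v : gL x (a *: u) v = a * gL x u v.
  exact: (scalable_of_scalar (fun b u1 u2 => linL x b u1 u2 v)).
have gNZ a u v : gN z (a *: u) v = a * gN z u v.
  exact: (scalable_of_scalar (fun b u1 u2 => linN z b u1 u2 v)).
rewrite (grad_sqE (v := (- wt *: gradient AL gL fL x,
  (ws / alpha x ^+ 2) *: gradient AN gN fN z))).
- rewrite /warped_metric/= !(gLZ, gNZ).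
  rewrite !(symL _ _ (_ *: _)) !(symN _ _ (_ *: _)) !(gLZ, gNZ).
  rewrite -/(grad_sq AL gL fL x) -/(grad_sq AN gN fN z).
  by field.
- by move=> v u; rewrite /warped_metric symL symN.
- move=> v; rewrite /warped_metric/= gLZ gNZ.
  rewrite (riemannian_gradientP _ _ rL) (riemannian_gradientP _ _ rN).
  rewrite (dfun_product _ mL mN sL sN dw) -/wt -/ws.
  by field.
Qed.

Theorem proposition2 (R : realType) (m n : nat) (hdim : (3 <= m + n)%N)
    (L N : topologicalType)
    (AL : charted 'rV[R]_m L) (AN : charted 'rV[R]_n N)
    (hL : smooth_manifold AL) (hN : smooth_manifold AN)
    (gL : tensor 'rV[R]_m L) (gN : tensor 'rV[R]_n N)
    (hgL : riemannian AL gL) (hgN : riemannian AN gN)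
    (connL : connected [set: L]) (connN : connected [set: N])
    (complL : complete_riemannian AL gL) (complN : complete_riemannian AN gN)
    (alpha : L -> R) (alpha_smooth : smooth_fun AL alpha)
    (alpha_pos : forall x, 0 < alpha x)
    (fL : L -> R) (fN : N -> R) (aL aN : R -> R)
    (hfL : transnormal_with AL gL fL aL) (hfN : transnormal_with AN gN fN aN)
    (F : (L * N) * (R * R) -> R)
    (hF : Ck_fun (charted_prod (charted_prod AL AN)
                    (charted_self ((R * R)%type : normedModType R))) 2 F)
    (F_inv : invariant_first fL fN F)
    (Fhat : range fL -> range fN -> R * R -> R)
    (hFhat : forall (t : range fL) (s : range fN) x z r tau,
       fL x = val t -> fN z = val s ->
       F ((x, z), (r, tau)) = Fhat t s (r, tau))
    (w : R * R -> R) (w_smooth : Cinf [set: R * R] w)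
    (alphahat : R -> R) (alphahat_smooth : Cinf [set: R] alphahat)
    (halpha : forall x, alpha x = alphahat (fL x)) :
  let A := charted_prod AL AN in
  let g := warped_metric gL gN alpha in
  let u := fun p : L * N => w (fL p.1, fN p.2) in
  let wt := fun t s : R => derive1 (fun t' : R => w (t', s)) t in
  let ws := fun t s : R => derive1 (fun s' : R => w (t, s')) s in
  (forall x z, F ((x, z), (u (x, z), grad_sq A g u (x, z))) = 0)
  <->
  (forall (t : range fL) (s : range fN),
     Fhat t s (w (val t, val s),
       - aL (val t) * wt (val t) (val s) ^+ 2
       + aN (val s) / alphahat (val t) ^+ 2 * ws (val t) (val s) ^+ 2) = 0).
Proof.
move=> A g u wt ws.
have [sL _ eL] := hfL; have [sN _ eN] := hfN.
have dw p : differentiable w p by have [+ _] := w_smooth 1%N; apply.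
have alpha_neq0 x : alpha x != 0 by rewrite gt_eqF.
have gradE x z : grad_sq A g u (x, z) =
    - aL (fL x) * wt (fL x) (fN z) ^+ 2 +
    aN (fN z) / alphahat (fL x) ^+ 2 * ws (fL x) (fN z) ^+ 2.
  by rewrite -eL -eN -halpha; apply: grad_sq_warped.
split=> [Fu t s|Fw x z].
  have /set_mem[x _ xt] := valP t; have /set_mem[z _ zs] := valP s.
  by rewrite -(hFhat t s x z)// -xt -zs -gradE; apply: Fu.
have xP : fL x \in range fL by apply/mem_set; exists x.
have zP : fN z \in range fN by apply/mem_set; exists z.
rewrite gradE (hFhat (Sub (fL x) xP) (Sub (fN z) zP))//.
Qed.
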